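(* Let $G=(V,E)$ be a finite connected graph with $d_{\min}\ge 2$. Then $$d_{\min}-2\sqrt{d_{\max}-1}\ \le\ \nu(G)\ \le\ \min_{x\sim y}\frac{d_x+d_y}{2}-1,$$ and for $d$-regular such graphs $$d-2\sqrt{d-1}\le\nu(G)\le d-1,$$ where the upper bound $d-1$ is attained for the complete graph $K_{d+1}$.
   Context: All graphs $G=(V,E)$ are finite and simple; $x\sim y$ denotes adjacency, $d_x$ is the degree of $x$, and $d_{\min}$, $d_{\max}$ are the minimal and maximal vertex degrees of $G$. $E^{or}(G)$ is the set of ordered pairs $(x,y)$ with $x\sim y$. A magnetic potential is a map $\sigma:E^{or}(G)\to S^1=\{z\in\mathbb{C}:|z|=1\}$ with $\sigma(y,x)=\sigma(x,y)^{-1}$. The magnetic Laplacian on functions $f:V\to\mathbb{C}$ is $\Delta^\sigma f(x)=\sum_{y\sim x}(f(x)-\sigma(x,y)f(y))$, and $\lambda_1^\sigma(G)$ is its smallest eigenvalue. The magneto-spectral height is $\nu(G)=\sup_\sigma\lambda_1^\sigma(G)$, over all magnetic potentials. *)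

(* Defs.v *)
From HB Require Import structures.
From mathcomp Require Import all_boot all_order all_algebra.
From mathcomp Require Import complex.
From mathcomp Require Import classical_sets reals.

Set Implicit Arguments.
Unset Strict Implicit.
Unset Printing Implicit Defensive.

Import Order.TTheory GRing.Theory Num.Theory.
Local Open Scope ring_scope.
Local Open Scope complex_scope.

Record sgraph := SGraph {
  vertex :> finType;
  adj : rel vertex;
  adj_sym : symmetric adj;
  adj_irr : irreflexive adj }.

Section Graphs.
Variable G : sgraph.

Definition deg (x : G) : nat := #|[pred y | adj x y]|.

(* On a graph with at least one vertex the default values #|G| and 0 do not
   affect the minimum and the maximum, since every degree is less than #|G|. *)
Definition min_deg : nat := \big[minn/#|G|]_(x : G) deg x.
Definition max_deg : nat := \max_(x : G) deg x.

Definition connected_graph : Prop :=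
  (0 < #|G|)%N /\ forall x y : G, connect (@adj G) x y.

Definition regular_graph (d : nat) : Prop := forall x : G, deg x = d.

(* The minimum of (d_x + d_y) / 2 over the edges.  The default value max_deg
   is an upper bound of all these averages, so it is harmless as soon as there
   is an edge. *)
Definition min_edge_deg (R : realFieldType) : R :=
  \big[Order.min/max_deg%:R]_(p : G * G | adj p.1 p.2)
    (((deg p.1)%:R + (deg p.2)%:R) / 2%:R).

End Graphs.

Lemma neq_sym (T : eqType) : symmetric (fun x y : T => x != y).
Proof. by move=> x y; rewrite eq_sym. Qed.

Lemma neq_irr (T : eqType) : irreflexive (fun x y : T => x != y).
Proof. by move=> x; rewrite eqxx. Qed.

Definition complete_graph (n : nat) : sgraph :=
  SGraph (@neq_sym 'I_n) (@neq_irr 'I_n).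

Section Magnetic.
Variables (R : realType) (G : sgraph).

(* A potential is a total function on pairs of vertices; its values on
   non-adjacent pairs are unconstrained and never used. *)
Definition magnetic_potential (sigma : G -> G -> R[i]) : Prop :=
  forall x y : G, adj x y ->
    `|sigma x y| = 1 /\ sigma y x = (sigma x y)^-1.

Definition magnetic_laplacian (sigma : G -> G -> R[i])
    (f : {ffun G -> R[i]^o}) : {ffun G -> R[i]^o} :=
  [ffun x => \sum_(y : G | adj x y) (f x - sigma x y * f y)].

Lemma magnetic_laplacian_is_linear sigma : linear (magnetic_laplacian sigma).
Proof.
move=> a f g; apply/ffunP => x; rewrite ffunE [RHS]ffunE [in RHS]ffunE.
rewrite [X in _ = a *: X + _]ffunE [X in _ = _ + X]ffunE.
have E y : (a *: f + g) y = a * f y + g y by rewrite !ffunE.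
rewrite scaler_sumr -big_split; apply: eq_bigr => y _; rewrite /= !E.
have -> : a *: (f x - sigma x y * f y) = a * (f x - sigma x y * f y) by [].
by rewrite mulrBr mulrDr opprD mulrCA addrACA.
Qed.

HB.instance Definition _ sigma :=
  GRing.isLinear.Build R[i] {ffun G -> R[i]^o} {ffun G -> R[i]^o} _
    (magnetic_laplacian sigma) (magnetic_laplacian_is_linear sigma).

(* The magnetic Laplacian of a potential is Hermitian, so its spectrum is a
   finite set of reals, nonempty if G is, and the infimum is its minimum. *)
Definition lambda1 (sigma : G -> G -> R[i]) : R :=
  inf [set r : R | passmx.leigenvalue (linfun (magnetic_laplacian sigma)) r%:C]%classic.

Definition magneto_spectral_height : R :=
  sup [set lambda1 sigma | sigma in [set s | magnetic_potential s]]%classic.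

End Magnetic.

(* Main.v *)
Require Import Defs.
From mathcomp Require Import all_boot all_order all_fingroup all_algebra.
From mathcomp Require Import complex reals ring lra.

(** The upper bound is a Rayleigh quotient: on an edge xy, for every potential
    sigma, the function with values 1 at x and sigma y x at y has quotient
    (d_x + d_y - 2) / 2 (lambda1_edge_le).  For the complete graph the constant
    potential -1 gives equality, because its Laplacian is (d - 1) Id plus the
    all-ones matrix.

    For the lower bound it is enough to find, for every rho > 2 sqrt (dmax - 1),
    signs on the edges such that the signed adjacency matrix B has all its
    eigenvalues below rho (height_lower).  They come from the interlacing
    families of Marcus, Spielman and Srivastava, in a form that works with
    positivity of principal minors in place of largest roots.

    Let p be the polynomial det (diag x - B) in one variable per vertex.  Its
    mixed derivatives are the principal minors of diag x - B, so their
    positivity at x = (rho, .., rho) means that rho - B is positive definite.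
    Three facts are combined.
    - Averaging p over the two signs of an edge uv applies the operator
      1 - d/dx_u d/dx_v (char_minor_mean).  This operator preserves stability,
      that is, the absence of zeros with all variables in the upper half plane
      (contract_stable).
    - Stability implies the Rayleigh inequalities at real points, and these
      imply that all mixed derivatives are positive as soon as p itself is and
      those that involve differentiation in one fixed variable x_u are
      (positive_at_extend).  The latter do not depend on the sign of uv.  So if
      the average over the two signs has positive derivatives, the same holds
      for one of the two signs (signing_exists).
    - The average over the signs of all the edges is the matching polynomial,
      with the matching polynomials of the induced subgraphs as derivatives;
      they are positive beyond 2 sqrt (dmax - 1) by the recursion of Heilmann
      and Lieb (matching_positive).

    The least eigenvalue is compared with Rayleigh quotients by means of the
    spectral theorem for Hermitian matrices (lambda1_spec). *)

Set Implicit Arguments.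
Unset Strict Implicit.
Unset Printing Implicit Defensive.

Import Order.TTheory GRing.Theory Num.Theory.
Local Open Scope ring_scope.

(** * Stable multiaffine families *)

Lemma setD1AC (T : finType) (A : {set T}) a b : A :\ a :\ b = A :\ b :\ a.
Proof. by apply/setP=> v; rewrite !inE andbCA. Qed.

(** A multiaffine polynomial p in variables indexed by T is
    represented by the family of all its mixed derivatives: g x S is the value
    at x of the derivative of p in the variables outside S, so that g x setT
    is p x.  For p = det (diag x - B) these are the principal minors. *)
Section Families.
Variables (C : numClosedFieldType) (T : finType).
Implicit Types (g : {ffun T -> C} -> {set T} -> C) (x y : {ffun T -> C}).
Implicit Types (S : {set T}) (u v w : T) (t : C).

Definition shift x w t : {ffun T -> C} :=
  [ffun v => x v + (if v == w then t else 0)].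

Definition upper_half x := forall v, 0 < 'Im (x v).

Definition multiaffine g := forall x S w t,
  g (shift x w t) S = g x S + (if w \in S then t * g x (S :\ w) else 0).

(** Since the derivatives of a stable polynomial are stable or zero, asking for
    nonvanishing of every member of the family excludes only the case of a
    zero derivative, which cannot occur for monic p. *)
Definition stable g := forall x S, upper_half x -> g x S != 0.

Definition real_valued g := forall x S,
  (forall v, x v \is Num.real) -> g x S \is Num.real.

(** The operator 1 - d/dx_u d/dx_v. *)
Definition contract u v g x S :=
  g x S - (if (u \in S) && (v \in S) then g x (S :\ u :\ v) else 0).

(** If the ratio r had imaginary part at most 0, adding - r to the variable w
    would stay in the upper half plane and annihilate g at S. *)
Lemma Im_ratio_gt0 g x S w : multiaffine g -> stable g -> upper_half x ->
  w \in S -> 0 < 'Im (g x S / g x (S :\ w)).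
Proof.
move=> gA gS xU wS; set r := _ / _.
case: (real_ltP (@real0 _) (Creal_Im r)) => // r_le0.
have yU : upper_half (shift x w (- r)).
  move=> v; rewrite ffunE raddfD /=; case: eqP => _; last by rewrite raddf0 addr0.
  by rewrite raddfN /= ltr_wpDr ?oppr_ge0.
have /negP[] := gS _ S yU.
by rewrite gA wS mulNr /r divfK ?gS ?subrr.
Qed.

Lemma contract_multiaffine u v g :
  u != v -> multiaffine g -> multiaffine (contract u v g).
Proof.
move=> uv gA x S w t; rewrite /contract !gA !inE.
have [->|wu] := eqVneq w u.
  rewrite /= (negPf uv) /=.
  by case uS: (u \in S); rewrite ?andbF /= ?addr0 ?subr0 //; case: ifP => _;
     rewrite ?addr0 ?subr0 // addrAC.
rewrite /=.
have [->|wv] := eqVneq w v.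
  rewrite /= andbF subr0 addr0.
  by case vS: (v \in S); rewrite ?andbF /= ?addr0 // addrAC.
rewrite /=.
have -> : S :\ u :\ v :\ w = S :\ w :\ u :\ v.
  by rewrite (setD1AC _ v w) (setD1AC S u w).
case: (w \in S); case: ifP => _; rewrite ?subr0 ?addr0 //.
by rewrite mulrBr opprD addrACA.
Qed.

(** A zero of g x S - g x (S :\ u :\ v) would make the ratio of g x S to
    g x (S :\ u) the inverse of the ratio of g x (S :\ u) to
    g x (S :\ u :\ v); but both ratios lie in the upper half plane, which
    inversion sends to the lower one. *)
Lemma contract_stable u v g :
  u != v -> multiaffine g -> stable g -> stable (contract u v g).
Proof.
move=> uv gA gS x S xU; rewrite /contract.
case: ifP => [/andP[uS vS]|_]; last by rewrite subr0 gS.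
rewrite subr_eq0; apply/eqP => gE.
have := Im_ratio_gt0 gA gS xU uS; rewrite gE -invf_div ImV.
have vSu : v \in S :\ u by rewrite !inE eq_sym uv.
rewrite mulNr oppr_gt0 => /lt_geF/negP; apply.
by rewrite divr_ge0 ?exprn_ge0 // ltW // (Im_ratio_gt0 gA gS xU vSu).
Qed.

Lemma contract_real u v g : real_valued g -> real_valued (contract u v g).
Proof.
move=> gR x S xR; rewrite /contract; apply: rpredB; first exact: gR.
by case: ifP => _; [apply: gR | apply: real0].
Qed.

Lemma quadratic_limit (a b c : C) :
  a \is Num.real -> b \is Num.real -> c \is Num.real ->
  (forall e, 0 < e -> 0 <= a + b * e + c * e ^+ 2) -> 0 <= a.
Proof.
move=> aR bR cR pos; case: (real_leP (@real0 _) aR) => // a_lt0.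
(* e = - a / s is below 1, so the terms in e and e ^+ 2 add up to at most
   (`|b| + `|c|) * e, which is less than - a. *)
pose s := `|b| + `|c| - a + 1.
have a_ge0 : 0 < - a by rewrite oppr_gt0.
have s_gt0 : 0 < s.
  by rewrite /s ltr_wpDl // addr_ge0 ?(ltW a_ge0) // addr_ge0.
pose e := - a / s; have e_gt0 : 0 < e by rewrite divr_gt0.
have bc0 : 0 <= `|b| + `|c| by rewrite addr_ge0.
have e_lt1 : e < 1.
  rewrite ltr_pdivrMr // mul1r /s -addrA [- a + 1]addrC addrA ltrDr.
  by rewrite ltr_wpDl.
suff lt0 : a + b * e + c * e ^+ 2 < 0 by rewrite -(lt_geF lt0) pos.
rewrite -addrA -ltrBrDl sub0r.
apply: (@le_lt_trans _ _ (`|b| * e + `|c| * e)).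
  have abs_le (z r : C) : z \is Num.real -> 0 <= r -> z * r <= `|z| * r.
    by move=> zR r0; rewrite ler_wpM2r // real_ler_norm.
  apply: lerD; first exact: abs_le (ltW e_gt0).
  apply: le_trans (abs_le _ _ cR _) _; first by rewrite exprn_ge0 ?ltW.
  by rewrite ler_wpM2l // expr2 ler_piMl ?ltW.
rewrite -mulrDl /e mulrA ltr_pdivrMr // mulrC ltr_pM2l //.
by rewrite /s -addrA ltrDl ltr_wpDr.
Qed.

(** The strict inequality of Im_ratio_gt0 passes to the boundary of the upper
    half plane: the variables are lowered to the real axis one at a time, and
    in each of them the expression is a polynomial of degree at most two. *)
Lemma Im_mul_conj_ge0 g x S w : multiaffine g -> stable g ->
  (forall v, 0 <= 'Im (x v)) -> w \in S ->
  0 <= 'Im (g x S * (g x (S :\ w))^*).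
Proof.
move=> gA gS xU wS.
suff H (s : seq T) y : (forall v, 0 <= 'Im (y v)) ->
    (forall v, v \notin s -> 0 < 'Im (y v)) ->
    0 <= 'Im (g y S * (g y (S :\ w))^*).
  by apply: (H (enum T) x) => // v; rewrite mem_enum inE.
elim: s y => [|u s IHs] y y0 ys.
  have yU : upper_half y by move=> v; apply: ys.
  have := Im_ratio_gt0 gA gS yU wS.
  have nR : `|g y (S :\ w)| ^- 2 \is Num.real by rewrite rpredV rpredX ?normr_real.
  rewrite invC_norm mulrCA (ImMl nR).
  by rewrite pmulr_rgt0 ?invr_gt0 ?exprn_gt0 ?normr_gt0 ?gS // => /ltW.
pose a := g y S; pose b := if u \in S then g y (S :\ u) else 0.
pose c := g y (S :\ w); pose d := if u \in S :\ w then g y (S :\ w :\ u) else 0.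
apply: (@quadratic_limit _ ('Im ('i * (b * c^* - a * d^*))) ('Im (b * d^*)));
  rewrite ?Creal_Im // => e e0.
have eR : e \is Num.real by rewrite realE ltW.
have {IHs} := IHs (shift y u ('i * e)).
have Imie : 'Im ('i * e) = e by rewrite ImMr // Im_i mul1r.
have shE v : 'Im (shift y u ('i * e) v) = 'Im (y v) + (if v == u then e else 0).
  by rewrite ffunE raddfD /=; case: eqP; rewrite ?Imie ?raddf0.
rewrite !gA -/a -/c.
have -> : (if u \in S then 'i * e * g y (S :\ u) else 0) = 'i * e * b.
  by rewrite /b; case: ifP => // _; rewrite mulr0.
have -> : (if u \in S :\ w then 'i * e * g y (S :\ w :\ u) else 0) = 'i * e * d.
  by rewrite /d; case: ifP => // _; rewrite mulr0.
have -> : (a + 'i * e * b) * (c + 'i * e * d)^* =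
  a * c^* + ('i * (b * c^* - a * d^*)) * e + b * d^* * e ^+ 2.
  rewrite rmorphD !rmorphM /= conjCi (CrealP eR).
  have i2 : 'i * 'i = -1 :> C by rewrite -expr2 sqrCi.
  by ring: i2.
rewrite !raddfD /= (ImMr eR) (ImMr (rpredX 2 eR)).
apply=> v; rewrite shE; first by rewrite addr_ge0 //; case: ifP; rewrite // ltW.
move=> vs; case: eqVneq => [_|vu]; first by rewrite ltr_wpDl.
by rewrite addr0 ys // inE negb_or vu.
Qed.

Definition real_point x := forall v, x v \is Num.real.

(** For the principal minors of diag x - B this is positive definiteness; for a
    stable family it says that x lies above all the zeros of the polynomial. *)
Definition positive_at g x := forall S, 0 < g x S.

(** At the real point x moved by 'i in the direction w, the imaginary part in
    Im_mul_conj_ge0 is exactly the difference of the two sides. *)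
Lemma rayleigh g x S u w : multiaffine g -> stable g -> real_valued g ->
  real_point x -> u != w -> u \in S -> w \in S ->
  g x S * g x (S :\ u :\ w) <= g x (S :\ u) * g x (S :\ w).
Proof.
move=> gA gS gR xR uw uS wS.
have y0 v : 0 <= 'Im (shift x w 'i v).
  rewrite ffunE raddfD /= (Creal_ImP _ (xR v)) add0r.
  by case: ifP; rewrite ?Im_i ?raddf0.
have := Im_mul_conj_ge0 gA gS y0 uS.
rewrite !gA wS !inE eq_sym uw wS /= rmorphD rmorphM /= conjCi.
rewrite !(CrealP (gR _ _ xR)).
set a := g x S; set b := g x (S :\ w); set c := g x (S :\ u).
set d := g x (S :\ u :\ w).
have i2 : 'i * 'i = -1 :> C by rewrite -expr2 sqrCi.
have -> : (a + 'i * b) * (c + - 'i * d) = (a * c + b * d) + 'i * (c * b - a * d).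
  by ring: i2.
by rewrite Im_rect ?subr_ge0 // ?(rpredB, rpredD, rpredM) ?gR.
Qed.

(** The analogue of Sylvester's criterion: positivity away from a single u
    and on the full set implies positivity everywhere.  Elements are removed
    from the full set one at a time, and the Rayleigh inequality for u and the
    removed w transfers positivity from S to S :\ w. *)
Lemma positive_at_extend g x u : multiaffine g -> stable g -> real_valued g ->
  real_point x -> (forall S, u \notin S -> 0 < g x S) -> 0 < g x setT ->
  positive_at g x.
Proof.
move=> gA gS gR xR pos posT S.
have [k] := ubnP #|~: S|; elim: k S => // k IHk S Sk.
have [->//|/existsP[w wS]] : S = setT \/ [exists w, w \notin S].
  case: (boolP [exists w, w \notin S]) => [|/existsPn H]; [by right|left].
  by apply/setP=> w; rewrite inE; apply: negbNE (H w).
case uS: (u \in S); last by rewrite pos ?uS.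
have uw : u != w by apply: contraNneq wS => <-.
have posW : 0 < g x (w |: S).
  apply: IHk; rewrite -ltnS; apply: leq_trans Sk; rewrite ltnS.
  apply: proper_card; apply/properP; split.
    by apply/subsetP=> v; rewrite !inE negb_or => /andP[].
  by exists w; rewrite !inE ?wS // eqxx.
have := rayleigh gA gS gR xR uw (setU1r w uS) (setU11 w S).
rewrite setU1K // => /(lt_le_trans _) H.
have {H} := H 0 (mulr_gt0 posW (pos _ _)).
rewrite pmulr_rgt0; first by apply; rewrite !inE eqxx ?andbF.
by apply: pos; rewrite !inE eqxx.
Qed.

(** Increasing one variable adds a nonnegative multiple of another member of
    the family. *)
Lemma positive_at_mono g x y : multiaffine g ->
  (forall v, x v <= y v) -> positive_at g x -> positive_at g y.
Proof.
move=> gA; suff H (s : seq T) (z : {ffun T -> C}) : (forall v, z v <= y v) ->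
    (forall v, v \notin s -> z v = y v) -> positive_at g z -> positive_at g y.
  by move=> xy; apply: (H (enum T)) => // v; rewrite mem_enum inE.
elim: s z => [|u s IHs] z zy zs gz.
  by have <- : z = y by apply/ffunP=> v; apply: zs.
apply: (IHs (shift z u (y u - z u))) => [v|v vs|S].
- by rewrite ffunE; case: eqP => [->|_]; rewrite ?addr0 // addrC subrK.
- rewrite ffunE; case: eqVneq => [->|vu]; first by rewrite addrC subrK.
  by rewrite addr0 zs // inE negb_or vu.
- rewrite gA; case: ifP => _; rewrite ?addr0 //.
  by rewrite ltr_wpDr // mulr_ge0 ?subr_ge0 // ltW.
Qed.

(** The operators are applied from the head of the list, so that the mean over
    the sign of the first edge can be taken before all the others are
    applied. *)
Definition contracts (H : seq (T * T)) g :=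
  foldl (fun g e => contract e.1 e.2 g) g H.

Lemma contracts_preserve H g : all (fun e => e.1 != e.2) H ->
  multiaffine g -> stable g -> real_valued g ->
  [/\ multiaffine (contracts H g), stable (contracts H g)
    & real_valued (contracts H g)].
Proof.
elim: H g => //= e H IHH g /andP[e12 He] gA gS gR; apply: IHH => //.
- exact: contract_multiaffine.
- exact: contract_stable.
- exact: contract_real.
Qed.

Lemma contracts_local H g h x u :
  (forall S, u \notin S -> g x S = h x S) ->
  forall S, u \notin S -> contracts H g x S = contracts H h x S.
Proof.
elim: H g h => //= e H IHH g h gh; apply: IHH => S uS.
by rewrite /contract !gh // !inE (negPf uS) !andbF.
Qed.

Lemma contracts_mean H g h k x :
  (forall S, g x S + h x S = 2%:R * k x S) ->
  forall S, contracts H g x S + contracts H h x S = 2%:R * contracts H k x S.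
Proof.
elim: H g h k => //= e H IHH g h k ghk; apply: IHH => S.
rewrite /contract mulrBr -ghk; case: ifP => _; last by rewrite !subr0 mulr0 subr0.
by rewrite -ghk opprD addrACA.
Qed.

End Families.

(** * Characteristic minors of a Hermitian matrix *)

Lemma det_row_affine (K : comNzRingType) n (A A1 A2 : 'M[K]_n) i0 c :
  (forall j, A i0 j = A1 i0 j + c * A2 i0 j) ->
  (forall i j, i != i0 -> A1 i j = A i j) ->
  (forall i j, i != i0 -> A2 i j = A i j) ->
  \det A = \det A1 + c * \det A2.
Proof.
move=> A0 E1 E2; rewrite (@determinant_multilinear _ n A A1 A2 i0 1 c) ?mul1r //.
- by apply/rowP=> j; rewrite !mxE A0 mul1r.
- by apply/matrixP=> i j; rewrite !mxE E1 // eq_sym neq_lift.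
- by apply/matrixP=> i j; rewrite !mxE E2 // eq_sym neq_lift.
Qed.

Section CharMinor.
Variables (C : numClosedFieldType) (n : nat).
Implicit Types (B : 'M[C]_n) (x : {ffun 'I_n -> C}) (S : {set 'I_n}).

(** Only the rows outside S are replaced by unit rows: the determinant is still
    the principal minor on S, and the dependence on each variable is confined
    to one row. *)
Definition char_minor_mx B x S : 'M[C]_n :=
  \matrix_(i, j) if i \in S then x i *+ (i == j) - B i j else (i == j)%:R.

Definition char_minor B x S := \det (char_minor_mx B x S).

Definition hermitian_mx B := forall i j, B j i = (B i j)^*.

Lemma char_minor_multiaffine B : multiaffine (char_minor B).
Proof.
move=> x S w t; case: ifP => wS; last first.
  rewrite addr0; congr (\det _); apply/matrixP=> i j; rewrite !mxE ffunE.
  by case: eqP => [->|_]; rewrite ?wS ?addr0.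
apply: (@det_row_affine _ _ _ _ _ w) => [j|i j iw|i j iw];
  rewrite !mxE ?inE ?eqxx ?wS ?ffunE ?(negPf iw) ?addr0 //=.
by rewrite eqxx mulrnDl -mulr_natr mulrnAr mulr1 mulr_natr addrAC.
Qed.

(** A kernel vector v is supported on S and gives the sum of x i * `|v i| ^+ 2
    the value of the Hermitian form of B at v, which is real. *)
Lemma char_minor_stable B : hermitian_mx B -> stable (char_minor B).
Proof.
move=> Bh x S xU; rewrite /char_minor -det_tr; apply/negP => /det0P[v v0 vM].
have vE i : if i \in S then x i * v 0 i = \sum_j B i j * v 0 j else v 0 i = 0.
  have := congr1 (fun w : 'rV_n => w 0 i) vM; rewrite !mxE.
  under eq_bigr => j _ do rewrite !mxE.
  case: ifP => iS; last first.
    rewrite (bigD1 i) //= eqxx mulr1 big1 ?addr0 // => j ji.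
    by rewrite eq_sym (negPf ji) mulr0.
  under eq_bigr => j _ do rewrite mulrBr.
  rewrite sumrB (bigD1 i) //= eqxx big1 ?addr0; last first.
    by move=> j ji; rewrite eq_sym (negPf ji) mulr0.
  move/eqP; rewrite subr_eq0 mulrC => /eqP ->.
  by apply: eq_bigr => j _; rewrite mulrC.
pose q := \sum_i \sum_j (v 0 i)^* * (B i j * v 0 j).
have qR : q \is Num.real.
  apply/CrealP; rewrite /q rmorph_sum exchange_big /=; apply: eq_bigr => j _.
  rewrite rmorph_sum; apply: eq_bigr => i _.
  rewrite !rmorphM /= conjCK -Bh; ring.
have qE : q = \sum_i x i * `|v 0 i| ^+ 2.
  apply: eq_bigr => i _; rewrite -mulr_sumr; have := vE i.
  case: ifP => iS => [<-|->]; last by rewrite conjC0 normr0 mul0r expr0n mulr0.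
  by rewrite normCK mulrCA [_^* * _]mulrC.
have : \sum_i 'Im (x i) * `|v 0 i| ^+ 2 = 0.
  rewrite -[RHS](Creal_ImP _ qR) qE raddf_sum /=; apply: eq_bigr => i _.
  by rewrite ImMr // rpredX // normr_real.
have ge0 i : 0 <= 'Im (x i) * `|v 0 i| ^+ 2.
  by rewrite mulr_ge0 ?exprn_ge0 // ltW.
move/eqP; rewrite psumr_eq0 // => /allP H.
case/negP: v0; apply/eqP/rowP=> i; rewrite mxE; apply/eqP.
have := H i (mem_index_enum _); rewrite mulf_eq0 gt_eqF ?xU //=.
by rewrite expf_eq0 normr_eq0.
Qed.

Definition principal_mx B x S : 'M[C]_n :=
  \matrix_(i, j) if (i \in S) && (j \in S) then x i *+ (i == j) - B i j
                 else (i == j)%:R.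

(** A permutation contributes to either determinant only if it fixes every
    index outside S, and then it preserves S. *)
Lemma char_minorE B x S : char_minor B x S = \det (principal_mx B x S).
Proof.
apply: eq_bigr => /= s _; congr (_ * _).
case: (boolP [forall i, (i \in S) || (s i == i)]) => [/forallP fix_s|].
  apply: eq_bigr => i _; rewrite !mxE; case iS: (i \in S) => //=.
  case siS: (s i \in S) => //; have := fix_s (s i).
  by rewrite siS /= (inj_eq perm_inj) => /eqP siE; rewrite siE iS in siS.
case/forallPn=> i; rewrite negb_or => /andP[iS sii].
by rewrite (bigD1 i) // [RHS](bigD1 i) //= !mxE (negPf iS) /= eq_sym
           (negPf sii) !mul0r.
Qed.

Lemma char_minor_local B B' x S :
  (forall i j, i \in S -> j \in S -> B i j = B' i j) ->
  char_minor B x S = char_minor B' x S.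
Proof.
move=> BB'; rewrite !char_minorE; congr (\det _); apply/matrixP=> i j.
by rewrite !mxE; case: ifP => // /andP[iS jS]; rewrite BB'.
Qed.

Lemma char_minor_real B : hermitian_mx B -> real_valued (char_minor B).
Proof.
move=> Bh x S xR; rewrite char_minorE.
apply/CrealP; rewrite -det_map_mx -[RHS]det_tr; congr (\det _).
apply/matrixP=> i j; rewrite !mxE andbC [j == i]eq_sym.
case: ifP => _; last by rewrite rmorph_nat.
rewrite rmorphB rmorphMn /= -Bh (CrealP (xR i)).
by case: eqP => [->|].
Qed.

(** Averaging over the sign of the edge uv kills the terms of odd degree in the
    sign; the term of degree two has the rows u and v replaced by the unit
    rows of v and u, which is minus the minor on S :\ u :\ v. *)
Lemma char_minor_mean B x S (u v : 'I_n) : u != v ->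
  let E : 'M[C]_n := delta_mx u v + delta_mx v u in
  char_minor (B + E) x S + char_minor (B - E) x S =
    2%:R * contract u v (char_minor B) x S.
Proof.
move=> uv E; have vu : v == u = false by rewrite eq_sym (negPf uv).
pose D (a b : 'I_n -> C) : C := \det (\matrix_(i, j)
  if i == u then a j else if i == v then b j else char_minor_mx B x S i j).
have Dl a a' b c : D (fun j => a j + c * a' j) b = D a b + c * D a' b.
  apply: (@det_row_affine _ _ _ _ _ u) => [j|i j iu|i j iu];
  by rewrite !mxE ?eqxx ?(negPf iu).
have Dr a b b' c : D a (fun j => b j + c * b' j) = D a b + c * D a b'.
  apply: (@det_row_affine _ _ _ _ _ v) => [j|i j iv|i j iv];
  by rewrite !mxE ?eqxx ?vu ?(negPf iv).
pose e (w j : 'I_n) : C := (w == j)%:R; pose r w j := char_minor_mx B x S w j.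
pose k w : C := (w \in S)%:R.
have DE (z : C) : char_minor (B + z *: E) x S =
   D (fun j => r u j + (- (z * k u)) * e v j) (fun j => r v j + (- (z * k v)) * e u j).
  congr (\det _); apply/matrixP=> i j; rewrite /r /k /e !mxE.
  case: (eqVneq i u) => [->|iu]; rewrite ?eqxx ?(negPf uv) /=.
    by case: (u \in S); rewrite ?mulr0 ?oppr0 ?mul0r ?addr0 // mulr1 mulNr
       opprD addrA [j == v]eq_sym.
  case: (eqVneq i v) => [->|iv]; rewrite /= ?addr0 ?mulr0 ?addr0 //.
  by case: (v \in S); rewrite ?mulr0 ?oppr0 ?mul0r ?addr0 // mulr1 mulNr
       add0r opprD addrA [j == u]eq_sym.
have -> : B + E = B + 1 *: E by rewrite scale1r.
have -> : B - E = B + (-1) *: E by rewrite scaleN1r.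
rewrite !DE !Dl !Dr /contract.
have -> : char_minor B x S = D (r u) (r v).
  congr (\det _); apply/matrixP=> i j; rewrite /r [RHS]mxE.
  by case: eqP => [->//|_]; case: eqP => [->|].
have De : D (e v) (e u) = - D (e u) (e v).
  rewrite /D; set M1 := (X in \det X = _); set M2 := (X in _ = - \det X).
  have -> : M1 = xrow u v M2.
    apply/matrixP=> i j; rewrite /xrow !mxE.
    case: tpermP => [->|->|/eqP iu /eqP iv]; rewrite ?eqxx ?vu //.
    by rewrite (negPf iu) (negPf iv).
  by rewrite xrowE det_mulmx det_perm odd_tperm uv expr1 mulN1r.
have Dk : k u * k v * D (e u) (e v) =
    if (u \in S) && (v \in S) then char_minor B x (S :\ u :\ v) else 0.
  rewrite /k; case uS: (u \in S); case vS: (v \in S); rewrite ?mulr0 ?mul0r //=.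
  rewrite !mul1r; congr (\det _); apply/matrixP=> i j; rewrite /e !mxE !inE.
  case: (eqVneq i u) => [->|iu] /=; first by rewrite andbF.
  by case: (eqVneq i v) => [->|iv].
by rewrite -Dk De; ring.
Qed.

End CharMinor.

(** * Matching polynomials beyond the Heilmann-Lieb bound *)

Section Matching.
Variables (C : numClosedFieldType) (T : finType).
Implicit Types (g : {ffun T -> C} -> {set T} -> C) (x : {ffun T -> C}).
Implicit Types (S : {set T}) (u v w a b : T) (m : T -> T -> nat).

(** The recursion satisfied by the matching polynomials of the induced
    subgraphs of the multigraph with m u v edges between u and v.
    Multiplicities make the effect of one more edge additive, whether or not
    that edge was already there. *)
Definition matching_rec m g x := forall S u, u \in S ->
  g x S = x u * g x (S :\ u)
          - \sum_(v in S :\ u) (m u v)%:R * g x (S :\ u :\ v).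

Definition add_edge a b m u v : nat :=
  (m u v + ((u, v) == (a, b)) + ((u, v) == (b, a)))%N.

Lemma matching_rec_contract_end m g x a b S : a != b -> a \in S ->
  matching_rec m g x ->
  contract a b g x S = x a * contract a b g x (S :\ a)
    - \sum_(v in S :\ a) (add_edge a b m a v)%:R * contract a b g x (S :\ a :\ v).
Proof.
move=> ab aS gm; have cS S' : a \notin S' -> contract a b g x S' = g x S'.
  by move=> aS'; rewrite /contract (negPf aS') subr0.
rewrite (cS (S :\ a)) ?setD11 // {1}/contract aS /= (gm S a aS) -addrA -opprD; congr (_ - _).
have sE v : v \in S :\ a ->
    (add_edge a b m a v)%:R * contract a b g x (S :\ a :\ v) =
    (m a v)%:R * g x (S :\ a :\ v) + (v == b)%:R * g x (S :\ a :\ v).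
  move=> _; rewrite cS ?inE ?eqxx ?andbF // /add_edge !xpair_eqE eqxx (negPf ab).
  by rewrite addn0 natrD mulrDl.
rewrite (eq_bigr _ sE) big_split /=; congr (_ + _).
case: ifP => bS; last first.
  rewrite big1 // => v; rewrite !inE => /andP[_ vS].
  by case: eqVneq vS => [->|_ _]; rewrite ?bS // mul0r.
rewrite (bigD1 b) /= ?inE 1?eq_sym ?ab // eqxx mul1r big1 ?addr0 //.
by move=> v /andP[_ /negPf ->]; rewrite mul0r.
Qed.

Lemma contractC a b g x S : contract a b g x S = contract b a g x S.
Proof. by rewrite /contract andbC setD1AC. Qed.

(** Applying 1 - d/dx_a d/dx_b to a matching polynomial adds the edge ab to
    the graph. *)
Lemma matching_rec_contract m g x a b : a != b -> matching_rec m g x ->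
  matching_rec (add_edge a b m) (contract a b g) x.
Proof.
move=> ab gm S u uS.
have [ua|ua] := eqVneq u a; first by subst u; apply: matching_rec_contract_end.
have [ub|ub] := eqVneq u b.
  subst u; rewrite !(contractC a b) (matching_rec_contract_end _ uS gm); last first.
    by rewrite eq_sym.
  congr (_ - _); apply: eq_bigr => v _; rewrite contractC; congr (_%:R * _).
  by rewrite /add_edge addnAC.
have mE v : add_edge a b m u v = m u v.
  by rewrite /add_edge !xpair_eqE (negPf ua) (negPf ub) !addn0.
under eq_bigr => v _ do rewrite mE.
rewrite /contract !inE ![_ == u]eq_sym ua ub /=.
case: (boolP ((a \in S) && (b \in S))) => abS; last first.
  rewrite !subr0 (gm S u uS); congr (_ - _); apply: eq_bigr => v _.
  rewrite !inE ifF ?subr0 //; apply: contraNF abS.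
  by case/andP => /and3P[_ _ ->] /and3P[_ _ ->].
have uS' : u \in S :\ a :\ b by rewrite !inE ua ub.
rewrite (gm S u uS) (gm _ u uS').
have eS v : S :\ u :\ v :\ a :\ b = S :\ a :\ b :\ u :\ v.
  by apply/setP=> w; rewrite !inE; do 4 case: eqVneq => //= _.
have eS1 : S :\ u :\ a :\ b = S :\ a :\ b :\ u.
  by apply/setP=> w; rewrite !inE; do 3 case: eqVneq => //= _.
rewrite eS1 [in RHS](eq_bigr _ (fun v _ => mulrBr _ _ _)) sumrB.
suff -> : \sum_(v in S :\ u) (m u v)%:R *
    (if (a \in S :\ u :\ v) && (b \in S :\ u :\ v)
     then g x (S :\ u :\ v :\ a :\ b) else 0) =
    \sum_(v in S :\ a :\ b :\ u) (m u v)%:R * g x (S :\ a :\ b :\ u :\ v).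
  by ring.
rewrite big_mkcond [RHS]big_mkcond; apply: eq_bigr => v _ /=.
rewrite eS !inE ![a == _]eq_sym ![b == _]eq_sym (negPf ua) (negPf ub) /=.
case/andP: abS => -> ->; rewrite !andbT.
by case: (v == u); case: (v == a); case: (v == b); case: (v \in S);
  rewrite /= ?mulr0.
Qed.

Lemma matching_rec_contracts H m g x : all (fun e => e.1 != e.2) H ->
  matching_rec m g x ->
  matching_rec (foldl (fun m e => add_edge e.1 e.2 m) m H) (contracts H g) x.
Proof.
elim: H m g => //= e H IHH m g /andP[e12 He] gm; apply: IHH => //.
exact: matching_rec_contract.
Qed.

Lemma foldl_add_edge H m u v :
  foldl (fun m e => add_edge e.1 e.2 m) m H u v =
  (m u v + count_mem (u, v) H + count_mem (v, u) H)%N.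
Proof.
elim: H m => [|[a b] H IHH] m; first by rewrite /= !addn0.
rewrite /= IHH /add_edge /= ![(a, b) == _]eq_sym !xpair_eqE [(v == a) && _]andbC.
by rewrite -!addnA; do 2 congr (_ + _)%N; rewrite addnCA.
Qed.

(** The proof of Heilmann and Lieb.  The induction carries along that the ratio
    of g x S to g x (S :\ u) is at least q as soon as u has a neighbour
    outside S.  Every neighbour of u in S satisfies this in S :\ u, as u
    itself is missing there; so the recursion bounds the ratio at S below by
    x u - N / q, where N is the degree of u within S.  If u has a neighbour
    outside S then N <= d = q ^+ 2, and this is at least q; otherwise
    N <= d + 1, and it is still positive because 2 * q ^+ 2 = 2 * d >= d + 1. *)
Lemma matching_positive m g x (q : C) (d : nat) : matching_rec m g x ->
  0 < g x set0 -> (forall u v, m u v = m v u) ->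
  (forall u, \sum_(v | v != u) m u v <= d.+1)%N -> (0 < d)%N ->
  0 < q -> q ^+ 2 = d%:R -> (forall u, 2%:R * q < x u) -> positive_at g x.
Proof.
move=> gm g0 mC mD d0 q0 q2 xq.
suff H k S : (#|S| <= k)%N -> 0 < g x S /\
    forall u w, u \in S -> w \notin S -> (0 < m u w)%N ->
      q * g x (S :\ u) <= g x S.
  by move=> S; have [] := H #|S| S (leqnn _).
elim: k S => [|k IHk] S.
  rewrite leqn0 cards_eq0 => /eqP ->; split=> // u w; by rewrite inE.
move=> Sk.
have key u (N : nat) : u \in S -> (\sum_(v in S :\ u) m u v <= N)%N ->
   0 < g x (S :\ u) /\ (q * x u - N%:R) * g x (S :\ u) <= q * g x S.
  move=> uS SN; have /IHk[gpos grat] : (#|S :\ u| <= k)%N.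
    by rewrite -ltnS; apply: leq_trans Sk; rewrite [X in (_ < X)%N](cardsD1 u) uS.
  split=> //; rewrite (gm S u uS) mulrBr mulrBl mulrA lerD2l lerN2 mulr_sumr.
  apply: (@le_trans _ _ (\sum_(v in S :\ u) (m u v)%:R * g x (S :\ u))).
    apply: ler_sum => v vS; case: (posnP (m u v)) => [->|mv].
      by rewrite !mul0r mulr0.
    rewrite mulrCA ler_wpM2l ?ler0n //.
    by apply: (grat v u); rewrite // ?setD11 // mC.
  by rewrite -mulr_suml -natr_sum ler_wpM2r ?(ltW gpos) // ler_nat.
have gS : 0 < g x S.
  have [->//|[u uS]] := set_0Vmem S.
  have [|gpos] := key u d.+1 uS.
    apply: leq_trans (mD u); rewrite [X in (_ <= X)%N]big_mkcond /= big_mkcond /=.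
    by apply: leq_sum => v _; rewrite !inE; case: (v != u) => //=; case: (v \in S).
  move=> le1; rewrite -(pmulr_rgt0 _ q0); apply: lt_le_trans le1.
  rewrite mulr_gt0 // subr_gt0.
  apply: (@le_lt_trans _ _ (q * (2%:R * q))); last by rewrite ltr_pM2l.
  rewrite mulrCA -expr2 q2 -natrM ler_nat mul2n -addnn -addn1 leq_add2l //.
split=> // u w uS wS mw.
have [|gpos] := key u d uS.
  rewrite -ltnS; apply: leq_trans (mD u).
  have wu : w != u by apply: contraNneq wS => ->.
  rewrite [X in (_ < X)%N](bigD1 w) //= -add1n leq_add //.
  rewrite [X in (_ <= X)%N]big_mkcond /= big_mkcond /=.
  apply: leq_sum => v _; rewrite !inE; case: (v != u) => //=.
  by case: (eqVneq v w) => [->|_] /=; [rewrite (negPf wS)|case: (v \in S)].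
move=> le1; rewrite -(ler_pM2l q0) mulrA; apply: le_trans le1.
rewrite ler_wpM2r ?(ltW gpos) // -q2 lerBrDr expr2 -mulrDr ler_pM2l //.
by rewrite -mulr2n -mulr_natl ltW.
Qed.

Lemma matching_rec_prod x :
  matching_rec (fun _ _ => 0%N) (fun x S => \prod_(i in S) x i) x.
Proof.
move=> S u uS; rewrite [X in _ - X]big1 ?subr0 => [|v _]; last by rewrite mul0r.
by rewrite (big_setD1 u).
Qed.

End Matching.

(** * Choosing the signs of the edges *)

Section Signing.
Variables (C : numClosedFieldType) (n : nat).
Local Notation arc := ('I_n * 'I_n)%type.

Lemma char_minor0 x S : char_minor (0 : 'M[C]_n) x S = \prod_(i in S) x i.
Proof.
rewrite char_minorE; set N := principal_mx _ _ _.
have -> : N = diag_mx (\row_i (if i \in S then x i else 1)).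
  apply/matrixP=> i j; rewrite !mxE subr0.
  case: (eqVneq i j) => [->|]; first by rewrite andbb !mulr1n.
  by case: ifP.
by rewrite det_diag [RHS]big_mkcond; apply: eq_bigr => i _; rewrite mxE.
Qed.

Definition sym_delta (e : arc) : 'M[C]_n := delta_mx e.1 e.2 + delta_mx e.2 e.1.

Lemma sym_deltaC e i j : sym_delta e j i = sym_delta e i j.
Proof. by rewrite !mxE addrC [(j == e.2) && _]andbC [(j == e.1) && _]andbC. Qed.

Lemma sym_delta_real e i j : (sym_delta e i j)^* = sym_delta e i j.
Proof. by rewrite !mxE rmorphD !rmorph_nat. Qed.

Lemma hermitian_add_delta (B : 'M[C]_n) (s : C) e : s \is Num.real ->
  hermitian_mx B -> hermitian_mx (B + s *: sym_delta e).
Proof.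
move=> sR Bh i j; rewrite mxE [in RHS]mxE rmorphD /= -Bh; congr (_ + _).
by rewrite mxE [in RHS]mxE rmorphM /= sym_delta_real sym_deltaC (CrealP sR).
Qed.

(** The signs are chosen one edge at a time.  For the first edge, the two
    families obtained from the signs 1 and -1 have as their mean the given
    positive family, so one of them is positive on the full set.  Both agree
    with that mean on the sets which avoid the end e.1 of the edge, and
    positive_at_extend does the rest. *)
Lemma signing_exists (H : seq arc) (B : 'M[C]_n) x : uniq H ->
  all (fun e => e.1 != e.2) H -> hermitian_mx B -> real_point x ->
  positive_at (contracts H (char_minor B)) x ->
  exists2 s : arc -> bool,
    hermitian_mx (B + \sum_(e <- H) (-1) ^+ s e *: sym_delta e) &
    positive_at (char_minor (B + \sum_(e <- H) (-1) ^+ s e *: sym_delta e)) x.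
Proof.
elim: H B => [|e H IHH] B /=.
  by move=> _ _ Bh _ pos; exists (fun _ => false); rewrite big_nil addr0.
move=> /andP[eH uH] /andP[e12 He] Bh xR pos.
pose Bs (b : bool) := B + (-1) ^+ b *: sym_delta e.
have sR (b : bool) : (-1) ^+ b \is @Num.real C by rewrite rpredX // rpredN rpred1.
have Bsh b : hermitian_mx (Bs b) by apply: hermitian_add_delta.
have nice b := contracts_preserve He (char_minor_multiaffine (Bs b))
                 (char_minor_stable (Bsh b)) (char_minor_real (Bsh b)).
have mean S : contracts H (char_minor (Bs false)) x S +
    contracts H (char_minor (Bs true)) x S =
    2%:R * contracts H (contract e.1 e.2 (char_minor B)) x S.
  apply: contracts_mean => S'.
  by rewrite /Bs expr0 expr1 scale1r scaleN1r char_minor_mean.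
have [b posT] : exists b, 0 < contracts H (char_minor (Bs b)) x setT.
  have hR b : contracts H (char_minor (Bs b)) x setT \is Num.real.
    by have [_ _] := nice b; apply.
  case: (real_ltP (@real0 _) (hR false)) => [|le0]; first by exists false.
  exists true; have := mulr_gt0 (@ltr0Sn C 1) (pos setT).
  by rewrite /= -mean => /lt_le_trans; apply; rewrite -lerBrDr subrr.
have posB : positive_at (contracts H (char_minor (Bs b))) x.
  have [gA gS gR] := nice b.
  apply: (@positive_at_extend _ _ _ _ e.1 gA gS gR xR) posT => S uS.
  have -> : contracts H (char_minor (Bs b)) x S =
      contracts H (contract e.1 e.2 (char_minor B)) x S; last exact: pos.
  apply: (@contracts_local _ _ H _ _ x e.1) uS => S' uS'.
  rewrite /contract (negPf uS') subr0; apply: char_minor_local => i j iS jS.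
  have iu : i == e.1 = false by apply: contraNF uS' => /eqP <-.
  have ju : j == e.1 = false by apply: contraNF uS' => /eqP <-.
  by rewrite /Bs !mxE iu ju andbF addr0 mulr0 addr0.
have [s sh spos] := IHH (Bs b) uH He (Bsh b) xR posB.
pose s' f := if f == e then b else s f.
have sumE : B + \sum_(f <- e :: H) (-1) ^+ s' f *: sym_delta f =
            Bs b + \sum_(f <- H) (-1) ^+ s f *: sym_delta f.
  rewrite big_cons {1}/s' eqxx addrA; congr (_ + _); apply: eq_big_seq => f fH.
  by rewrite /s'; case: eqP fH eH => // -> ->.
by exists s'; rewrite sumE.
Qed.

End Signing.

Section GoodSigning.
Variables (C : numClosedFieldType) (n : nat) (a : rel 'I_n).
Hypotheses (a_sym : symmetric a) (a_irr : irreflexive a).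
Local Notation arc := ('I_n * 'I_n)%type.

(* Each edge is listed once, from its smaller to its larger end. *)
Let oriented (e : arc) := (e.1 < e.2)%N && a e.1 e.2.
Let H := [seq e <- index_enum (arc : finType) | oriented e].

Let H_uniq : uniq H. Proof. by rewrite filter_uniq ?index_enum_uniq. Qed.

Let H_neq : all (fun e => e.1 != e.2) H.
Proof.
apply/allP=> e; rewrite mem_filter => /andP[/andP[lt12 _] _].
by apply: contraTneq lt12 => ->; rewrite ltnn.
Qed.

Let mult_H u v : foldl (fun m e => add_edge e.1 e.2 m) (fun _ _ => 0%N) H u v
  = a u v :> nat.
Proof.
rewrite foldl_add_edge !count_uniq_mem // /H !mem_filter !mem_index_enum !andbT /oriented.
rewrite /= [a v u]a_sym add0n; case: (ltngtP u v) => [uv|uv|/val_inj ->] /=;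
  by rewrite ?addn0 ?a_irr.
Qed.

Let B (s : arc -> bool) : 'M[C]_n :=
  0 + \sum_(e <- H) (-1) ^+ s e *: sym_delta C e.

Let B_entry s (i j : 'I_n) : (i < j)%N ->
  B s i j = if a i j then (-1) ^+ s (i, j) else 0.
Proof.
move=> ij; rewrite /B add0r big_filter /= summxE.
have zero e : oriented e -> e != (i, j) -> ((-1) ^+ s e *: sym_delta C e) i j = 0.
  case: e => e1 e2 /andP[/= e12 _]; rewrite xpair_eqE !mxE /=.
  rewrite [i == e1]eq_sym [j == e2]eq_sym => /negPf -> /=; rewrite add0r.
  case: (eqVneq i e2) => [ie|]; last by rewrite mulr0.
  case: (eqVneq j e1) => [je|]; last by rewrite mulr0.
  by rewrite ie je ltnNge ltnW in ij.
case: ifP => aij; last first.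
  rewrite big1 // => e eo; apply: (zero e eo).
  by apply: contraFneq aij => ee; move: eo; rewrite ee => /andP[].
rewrite (bigD1 (i, j)) /= ?/oriented /= ?ij //.
rewrite big1 ?addr0 => [|e /andP[eo ne]]; last exact: zero.
have ji : j == i = false by apply: contraTF ij => /eqP ->; rewrite ltnn.
by rewrite !mxE /= !eqxx [i == j]eq_sym ji addr0 mulr1.
Qed.

(** After all edges have been averaged only the matching polynomial is left. *)
Lemma good_signing (x : {ffun 'I_n -> C}) (q : C) d : (0 < d)%N ->
  (forall i, \sum_j a i j <= d.+1)%N -> 0 < q -> q ^+ 2 = d%:R ->
  (forall i, 2%:R * q < x i) ->
  exists s : 'I_n -> 'I_n -> bool, (forall i j, s i j = s j i) /\
    positive_at
      (char_minor (\matrix_(i, j) if a i j then (-1) ^+ s i j else 0)) x.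
Proof.
move=> d0 deg_le q0 q2 xq.
have xR : real_point x.
  by move=> i; rewrite realE (@ltW _ _ 0) // (lt_trans _ (xq i)) // mulr_gt0.
have h0 : hermitian_mx (0 : 'M[C]_n) by move=> i j; rewrite !mxE rmorph0.
have pos : positive_at (contracts H (char_minor (0 : 'M[C]_n))) x.
  have rec0 : matching_rec (fun _ _ => 0%N) (char_minor (0 : 'M[C]_n)) x.
    move=> S u uS; rewrite !char_minor0 (matching_rec_prod x uS).
    by congr (_ - _); apply: eq_bigr => v _; rewrite !mul0r.
  apply: (matching_positive (matching_rec_contracts H_neq rec0) _ _ _ d0 q0 q2 xq).
  - suff -> : contracts H (char_minor (0 : 'M[C]_n)) x set0 =
              char_minor (0 : 'M[C]_n) x set0 by rewrite char_minor0 big_set0.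
    elim: (H) (char_minor _) => //= e H' IHH g.
    by rewrite IHH /contract inE subr0.
  - by move=> u v; rewrite !mult_H a_sym.
  - move=> u; apply: leq_trans (deg_le u).
    rewrite big_mkcond /=; apply: leq_sum => v _; rewrite mult_H.
    by case: ifP.
have [s sh spos] := signing_exists H_uniq H_neq h0 xR pos.
exists (fun i j : 'I_n => if (i < j)%N then s (i, j) else s (j, i)); split.
  by move=> i j; case: (ltngtP i j) => // /val_inj ->.
set B' := \matrix_(i, j) _; suff <- : B s = B' by [].
apply/matrixP=> i j; rewrite [RHS]mxE; case: (ltngtP i j) => [ij|ij|/val_inj ->].
- by rewrite B_entry.
- rewrite /B [LHS]sh -/(B s) B_entry // a_sym; case: ifP; rewrite ?rmorph0 //.
  by rewrite rmorphXn /= rmorphN rmorph1.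
- rewrite a_irr /B add0r big_filter /= summxE big1 // => e.
  case: e => e1 e2 /andP[/= e12 _]; rewrite !mxE /=.
  case: (eqVneq j e1) => [->|_]; rewrite ?andbF ?addr0 ?mulr0 //=.
  case: (eqVneq e1 e2) e12 => [->|_ _]; rewrite ?ltnn //= ?addr0 ?mulr0 //.
Qed.

End GoodSigning.

(** * The least eigenvalue of a Hermitian matrix *)

Section LeastEigenvalue.
Local Open Scope sesquilinear_scope.

Lemma spectral_decomposition (C : numClosedFieldType) n (L : 'M[C]_n) :
  hermitian_mx L ->
  exists P (D : 'rV[C]_n), [/\ P^t* *m P = 1%:M, P *m P^t* = 1%:M,
    (forall i, D 0 i \is Num.real) & L = P^t* *m diag_mx D *m P].
Proof.
move=> Lh.
have Lherm : L \is hermsymmx.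
  apply/is_hermitianmxP; rewrite expr0 scale1r; apply/matrixP=> i j.
  by rewrite !mxE -Lh.
have PU := spectral_unitarymx L; have PPt := unitarymxP PU.
exists (spectralmx L), (spectral_diag L); split=> //.
- exact: mulmx1C.
- move=> i; have /mxOverP := hermitian_spectral_diag_real Lherm; exact.
- rewrite -invmx_unitary //; apply/orthomx_spectralP.
  exact: hermitian_normalmx.
Qed.

Lemma min_eigenvalue (C : numClosedFieldType) n (L : 'M[C]_n) : (0 < n)%N ->
  hermitian_mx L ->
  exists2 mu : C, mu \is Num.real &
    (exists2 c : 'cV[C]_n, c != 0 & L *m c = mu *: c) /\
    (forall c : 'cV[C]_n, mu * (c^t* *m c) 0 0 <= (c^t* *m L *m c) 0 0).
Proof.
move=> n0 Lh; have [P [D [PtP PPt DR LE]]] := spectral_decomposition Lh.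
have [k kmin] : exists k, forall i, D 0 k <= D 0 i.
  have [k _ kmin] :=
    real_arg_minP (i0 := Ordinal n0) (P := xpredT) isT (fun i _ => DR i).
  by exists k => i; apply: kmin.
exists (D 0 k); first exact: DR.
split.
  exists (P^t* *m delta_mx k 0).
    apply/eqP => c0; have := congr1 (fun c => (P *m c) k 0) c0.
    rewrite /= mulmxA PPt mul1mx mulmx0 !mxE !eqxx => /eqP.
    by rewrite oner_eq0.
  rewrite LE -!mulmxA [P *m _]mulmxA PPt mul1mx scalemxAr; congr (_ *m _).
  apply/matrixP=> i j; rewrite mul_diag_mx !mxE ord1 eqxx andbT.
  by case: eqVneq => [->|]; rewrite ?mulr0.
move=> c; pose y := P *m c.
have yt : c^t* *m P^t* = y^t* by rewrite /y trmx_mul map_mxM.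
have -> : c^t* *m L *m c = y^t* *m diag_mx D *m y by rewrite LE -yt !mulmxA.
have -> : c^t* *m c = y^t* *m y.
  by rewrite -yt /y mulmxA -(mulmxA _ _ P) PtP mulmx1.
clearbody y; rewrite -mulmxA mul_diag_mx !mxE mulr_sumr.
apply: ler_sum => i _; rewrite !mxE [leRHS]mulrCA ler_wpM2r //.
by rewrite mulrC -normCK exprn_ge0.
Qed.

End LeastEigenvalue.

(** * The spectrum of the magnetic Laplacian *)

Section Spectrum.
Local Open Scope complex_scope.
Variables (R : realType) (G : sgraph).
Implicit Types (sigma : G -> G -> R[i]) (f : {ffun G -> R[i]^o}) (x y : G).
Local Notation Delta := magnetic_laplacian.

Lemma leigenvalueP sigma (a : R[i]) :
  passmx.leigenvalue (linfun (Delta sigma)) a <->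
  exists2 f, f != 0 & forall x, Delta sigma f x = a * f x.
Proof.
have kerE f : f \in passmx.leigenspace (linfun (Delta sigma)) a <->
    forall x, Delta sigma f x = a * f x.
  rewrite memv_ker !lfunE /= !lfunE /= lfunE /= ?id_lfunE subr_eq0; split.
    by move/eqP=> E x; rewrite E ffunE.
  by move=> E; apply/eqP/ffunP=> x; rewrite E ffunE.
split=> [nz|[f f0 /kerE fker]].
  exists (vpick (passmx.leigenspace (linfun (Delta sigma)) a)).
    by rewrite vpick0.
  exact/kerE/memv_pick.
by apply: contraNneq f0 => ker0; rewrite -memv0 -ker0.
Qed.

Definition laplacian_mx sigma : 'M[R[i]]_#|G| := \matrix_(i, j)
  ((deg (enum_val i))%:R *+ (i == j) -
   (if adj (enum_val i) (enum_val j) then sigma (enum_val i) (enum_val j) else 0)).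

Definition vertex_col f : 'cV[R[i]]_#|G| := \col_i f (enum_val i).

Lemma sum_vertices (V : nmodType) (F : G -> V) :
  \sum_x F x = \sum_(i < #|G|) F (enum_val i).
Proof. exact: (reindex _ (onW_bij _ (@enum_val_bij G))). Qed.

Lemma magnetic_laplacianE sigma f x :
  Delta sigma f x = (deg x)%:R * f x - \sum_(y | adj x y) sigma x y * f y.
Proof.
rewrite ffunE sumrB; congr (_ - _).
by rewrite sumr_const mulr_natl.
Qed.

Lemma laplacian_mxE sigma f :
  laplacian_mx sigma *m vertex_col f = vertex_col (Delta sigma f).
Proof.
apply/matrixP=> i j; rewrite !mxE magnetic_laplacianE.
under eq_bigr => k _ do rewrite !mxE mulrBl.
rewrite sumrB; congr (_ - _).
  rewrite (bigD1 i) //= eqxx big1 ?addr0 // => k ki.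
  by rewrite eq_sym (negPf ki) mul0r.
rewrite [RHS]big_mkcond [RHS]sum_vertices; apply: eq_bigr => k _.
by case: ifP; rewrite ?mul0r.
Qed.

Lemma vertex_colK (c : 'cV[R[i]]_#|G|) :
  vertex_col [ffun x => c (enum_rank x) 0] = c.
Proof. by apply/matrixP=> i j; rewrite !mxE ffunE enum_valK ord1. Qed.

Lemma vertex_col_eq0 f : (vertex_col f == 0) = (f == 0).
Proof.
apply/eqP/eqP => [f0|->]; last by apply/matrixP=> i j; rewrite !mxE ffunE.
apply/ffunP=> x; have := congr1 (fun c : 'cV_#|G| => c (enum_rank x) 0) f0.
by rewrite !mxE enum_rankK ffunE.
Qed.

Lemma laplacian_mx_hermitian sigma :
  magnetic_potential sigma -> hermitian_mx (laplacian_mx sigma).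
Proof.
move=> ms i j; rewrite !mxE rmorphB rmorphMn /= rmorph_nat eq_sym.
congr (_ - _); first by case: eqP => [->|].
rewrite adj_sym; case: ifP => [aij|_]; last by rewrite rmorph0.
have [n1 ->] := ms _ _ aij.
by rewrite invC_norm n1 expr1n invr1 mul1r.
Qed.

Definition sqnorm f : R[i] := \sum_x `|f x| ^+ 2.
Definition energy sigma f : R[i] := \sum_x (f x)^* * Delta sigma f x.

Lemma sqnorm_gt0 f : f != 0 -> 0 < sqnorm f.
Proof.
move=> f0; rewrite lt_def sumr_ge0 ?andbT => [|x _]; last exact: exprn_ge0.
apply: contraNneq f0 => /eqP; rewrite psumr_eq0 => [|x _]; last exact: exprn_ge0.
move/allP=> H; apply/eqP/ffunP=> x; rewrite ffunE.
have := H x (mem_index_enum _); rewrite expf_eq0 normr_eq0 /=.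
by move/eqP.
Qed.

(** The infimum defining lambda1 is attained, and satisfies the variational
    characterization of the least eigenvalue. *)
Lemma lambda1_spec sigma : (0 < #|G|)%N -> magnetic_potential sigma ->
  (exists2 f, f != 0 & forall x, Delta sigma f x = (lambda1 sigma)%:C * f x) /\
  (forall f, (lambda1 sigma)%:C * sqnorm f <= energy sigma f).
Proof.
move=> G0 ms.
have [mu muR [[c c0 Lc] mumin]] := min_eigenvalue G0 (laplacian_mx_hermitian ms).
have [r mu_r] : exists r : R, mu = r%:C.
  by exists (complex.Re mu); rewrite complexRe (Creal_ReP _ muR).
have eig : exists2 f, f != 0 & forall x, Delta sigma f x = r%:C * f x.
  exists [ffun x => c (enum_rank x) 0].
    by rewrite -vertex_col_eq0 vertex_colK.
  move=> x; have := laplacian_mxE sigma [ffun x => c (enum_rank x) 0].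
  rewrite vertex_colK Lc -mu_r => /matrixP/(_ (enum_rank x) 0).
  by rewrite !mxE enum_rankK !ffunE => <-.
have rmin f : r%:C * sqnorm f <= energy sigma f.
  have := mumin (vertex_col f); rewrite -mulmxA laplacian_mxE !mxE -mu_r.
  rewrite /sqnorm /energy !sum_vertices.
  under eq_bigr => i _ do rewrite !mxE mulrC -normCK.
  by under [X in _ <= X -> _]eq_bigr => i _ do rewrite !mxE.
suff -> : lambda1 sigma = r by [].
have lbr : classical_sets.lbound (classical_sets.mkset
    (fun r : R => passmx.leigenvalue (linfun (Delta sigma)) r%:C)) r.
  move=> r' /leigenvalueP[f f0 fr']; have := rmin f.
  have -> : energy sigma f = r'%:C * sqnorm f.
    rewrite /energy /sqnorm mulr_sumr; apply: eq_bigr => x _.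
    by rewrite fr' normCK; ring.
  by rewrite ler_pM2r ?sqnorm_gt0 // lecR.
apply/le_anti/andP; split.
  by apply: ge_inf; [exists r|apply/leigenvalueP].
by apply: lb_le_inf => //; exists r; apply/leigenvalueP.
Qed.

Lemma card_vertices_gt0 (x : G) : (0 < #|G|)%N.
Proof. by apply/card_gt0P; exists x. Qed.

(** The gauge of the test function f makes its two values cancel as much as
    possible along the edge, whence energy d_x + d_y - 2, while its squared
    norm is 2. *)
Lemma lambda1_edge_le sigma x y : magnetic_potential sigma -> adj x y ->
  lambda1 sigma <= ((deg x)%:R + (deg y)%:R) / 2%:R - 1.
Proof.
move=> ms xy; have [_ /(_ _)] := lambda1_spec (card_vertices_gt0 x) ms.
have xny : x == y = false by apply: contraTF xy => /eqP ->; rewrite adj_irr.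
have yx : adj y x by rewrite adj_sym.
pose f : {ffun G -> R[i]^o} :=
  [ffun z => if z == x then 1 else if z == y then sigma y x else 0].
move/(_ f).
have [n1 sE] := ms _ _ yx.
have s0 : sigma y x != 0 by rewrite -normr_eq0 n1 oner_eq0.
have fx : f x = 1 by rewrite ffunE eqxx.
have fy : f y = sigma y x by rewrite ffunE eq_sym xny eqxx.
have fz z : z != x -> z != y -> f z = 0.
  by move=> zx zy; rewrite ffunE (negPf zx) (negPf zy).
have sum2 (F : G -> R[i]) : (forall z, z != x -> z != y -> F z = 0) ->
    \sum_z F z = F x + F y.
  move=> F0; rewrite (bigD1 x) //= (bigD1 y) /= 1?eq_sym ?xny //.
  by rewrite big1 ?addr0 // => z /andP[]; apply: F0.
have Dx : Delta sigma f x = (deg x)%:R - 1.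
  rewrite magnetic_laplacianE fx mulr1 big_mkcond sum2 => [|z zx zy].
    by rewrite adj_irr xy fy sE mulVf // add0r.
  by rewrite fz // mulr0 if_same.
have Dy : Delta sigma f y = ((deg y)%:R - 1) * sigma y x.
  rewrite magnetic_laplacianE fy big_mkcond sum2 => [|z zx zy].
    by rewrite adj_irr yx fx addr0 mulr1 mulrBl mul1r.
  by rewrite fz // mulr0 if_same.
rewrite /sqnorm sum2 => [|z zx zy]; last by rewrite fz // normr0 expr0n.
rewrite /energy sum2 => [|z zx zy]; last by rewrite fz // conjC0 mul0r.
rewrite Dx Dy fx fy normr1 n1 conjC1 expr1n mul1r mulrCA [_^* * _]mulrC -normCK n1.
rewrite expr1n mulr1.
have -> : (deg x)%:R - 1 + ((deg y)%:R - 1) =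
   ((deg x)%:R + (deg y)%:R - 2%:R)%:C :> R[i].
  by rewrite rmorphB rmorphD /= !rmorph_nat; ring.
have -> : 1 + 1 = 2%:R%:C :> R[i] by rewrite rmorph_nat.
by rewrite -rmorphM lecR; lra.
Qed.

Lemma potential1 : magnetic_potential (fun _ _ : G => 1 : R[i]).
Proof. by move=> x y _; rewrite normr1 invr1. Qed.

Lemma height_edge_le x y : adj x y ->
  magneto_spectral_height R G <= ((deg x)%:R + (deg y)%:R) / 2%:R - 1.
Proof.
move=> xy; apply: ge_sup.
  by exists (lambda1 (fun _ _ : G => 1 : R[i])); exists (fun _ _ => 1) => //;
     apply: potential1.
by move=> _ [sigma ms <-]; apply: lambda1_edge_le.
Qed.

Lemma height_ge sigma x y : adj x y -> magnetic_potential sigma ->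
  lambda1 sigma <= magneto_spectral_height R G.
Proof.
move=> xy ms; apply: ub_le_sup; last by exists sigma.
exists (((deg x)%:R + (deg y)%:R) / 2%:R - 1) => _ [tau mt <-].
exact: lambda1_edge_le.
Qed.

Lemma sign_potential (s : G -> G -> bool) : (forall x y, s x y = s y x) ->
  magnetic_potential (fun x y => (-1) ^+ s x y : R[i]).
Proof.
move=> ss x y _; rewrite normrX normrN1 expr1n; split=> //.
by rewrite ss; case: (s x y); rewrite ?expr1 ?invrN ?invr1.
Qed.

Lemma sum_adj x : (\sum_y adj x y)%N = deg x.
Proof.
rewrite /deg -sum1_card [RHS]big_mkcond; apply: eq_bigr => y _.
by rewrite inE; case: adj.
Qed.

(** For rho > 2 sqrt d there are signs with rho - B positive definite, where B
    is the signed adjacency matrix.  An eigenvalue l < m - rho would make the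
    matrix diag (deg - l) - B singular, although its diagonal part is at least
    rho. *)
Lemma height_lower m d x0 y0 : adj x0 y0 -> (0 < d)%N ->
  (forall x, (m <= deg x <= d.+1)%N) ->
  m%:R - 2%:R * Num.sqrt d%:R <= magneto_spectral_height R G.
Proof.
move=> xy0 d0 degb; apply/ler_addgt0Pr => e e0.
pose rho : R := 2%:R * Num.sqrt d%:R + e.
pose a : rel 'I_#|G| := fun i j => adj (enum_val i) (enum_val j).
have a_sym : symmetric a by move=> i j; apply: adj_sym.
have a_irr : irreflexive a by move=> i; apply: adj_irr.
have q0 : 0 < (Num.sqrt d%:R)%:C :> R[i] by rewrite ltcR sqrtr_gt0 ltr0n.
have q2 : (Num.sqrt d%:R)%:C ^+ 2 = d%:R :> R[i].
  by rewrite -rmorphXn /= sqr_sqrtr ?ler0n // rmorph_nat.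
have [|i|s [ss pos]] := @good_signing R[i] #|G| a a_sym a_irr
    [ffun => rho%:C] (Num.sqrt d%:R)%:C d d0 _ q0 q2.
- move=> i; have := sum_adj (enum_val i); rewrite sum_vertices => ->.
  by have /andP[] := degb (enum_val i).
- rewrite ffunE -[2%:R](rmorph_nat (real_complex R)) -rmorphM ltcR.
  by rewrite /rho ltrDl.
pose sigma x y : R[i] := (-1) ^+ s (enum_rank x) (enum_rank y).
have ms : magnetic_potential sigma by apply: sign_potential => x y; apply: ss.
rewrite -lerBlDr; apply: le_trans (height_ge xy0 ms).
rewrite -addrA -opprD -/rho leNgt; apply/negP => lt_l.
have [[f f0 fE] _] := lambda1_spec (card_vertices_gt0 x0) ms.
set l := lambda1 sigma in lt_l fE.
pose z : {ffun 'I_#|G| -> R[i]} := [ffun i => ((deg (enum_val i))%:R - l)%:C].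
have rz i : [ffun => rho%:C] i <= z i.
  rewrite !ffunE lecR.
  have : m%:R <= (deg (enum_val i))%:R :> R.
    by rewrite ler_nat; have /andP[] := degb (enum_val i).
  by lra.
have := positive_at_mono (char_minor_multiaffine _) rz pos setT.
set B := \matrix_(i, j) _.
have ME : char_minor_mx B z setT = laplacian_mx sigma - l%:C%:M.
  apply/matrixP=> i j; rewrite !mxE inE ffunE rmorphB rmorph_nat mulrnBl.
  by rewrite /a /sigma !enum_valK addrAC.
rewrite /char_minor ME => det_gt0; case/negP: f0; rewrite -vertex_col_eq0.
have U : laplacian_mx sigma - l%:C%:M \in unitmx.
  by rewrite unitmxE unitfE gt_eqF.
rewrite -[vertex_col f](mulKmx U) mulmxBl laplacian_mxE mul_scalar_mx.
suff -> : vertex_col (Delta sigma f) - l%:C *: vertex_col f = 0.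
  by rewrite mulmx0.
by apply/matrixP=> i j; rewrite !mxE fE subrr.
Qed.

End Spectrum.

(** * Complete graphs and degree bounds *)

Section Complete.
Local Open Scope complex_scope.
Variable R : realType.

Lemma deg_complete n (x : complete_graph n.+1) : deg x = n.
Proof.
have -> : deg x = #|predC1 x| by apply: eq_card => y; rewrite !inE eq_sym.
by rewrite cardC1 card_ord.
Qed.

(** For the constant potential -1 the Laplacian of the complete graph is
    (d - 1) times the identity plus the all-ones matrix, whose eigenvalues are
    0 and d + 1. *)
Lemma height_complete_ge d : (0 < d)%N ->
  d%:R - 1 <= magneto_spectral_height R (complete_graph d.+1).
Proof.
move=> d0; pose G := complete_graph d.+1.
have xy : adj (ord0 : G) (ord_max : G) by rewrite /= -val_eqE /= neq_ltn d0.
have ms : magnetic_potential (fun _ _ : G => -1 : R[i]).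
  by move=> x y _; rewrite normrN1 invrN invr1.
apply: le_trans (height_ge xy ms).
have [[f f0 fE] _] := lambda1_spec (card_vertices_gt0 (ord0 : G)) ms.
set l := lambda1 _ in fE *.
pose F := \sum_x f x.
have eqx x : (d%:R - 1 - l%:C) * f x = - F.
  have := fE x; rewrite magnetic_laplacianE deg_complete /= => E.
  have -> : F = f x + \sum_(y | x != y) f y.
    by rewrite /F (bigD1 x) //=; congr (_ + _); apply: eq_bigl => y; rewrite eq_sym.
  move: E; under eq_bigr => y _ do rewrite mulN1r.
  rewrite sumrN opprK => E; rewrite mulrBl -E; ring.
have [F0|F0] := eqVneq F 0.
  have [x fx] : exists x, f x != 0.
    apply/existsP; apply: contraR f0 => /existsPn H; apply/eqP/ffunP=> x.
    by rewrite ffunE; apply/eqP; have := H x; rewrite negbK.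
  have /eqP := eqx x; rewrite F0 oppr0 mulf_eq0 (negPf fx) orbF subr_eq0.
  by rewrite -(rmorph_nat (real_complex R)) -(rmorph1 (real_complex R)) -rmorphB
     => /eqP/complexI ->.
have : (d%:R - 1 - l%:C) * F = - (d.+1)%:R * F.
  rewrite {1}/F mulr_sumr (eq_bigr _ (fun x _ => eqx x)) sumr_const.
  by rewrite card_ord mulNr mulNrn mulr_natl.
move/(mulIf F0); rewrite -!(rmorph_nat (real_complex R)).
rewrite -(rmorph1 (real_complex R)) -!rmorphB -rmorphN => /complexI.
rewrite -natr1 => H; have : 0 <= d%:R :> R by rewrite ler0n.
by lra.
Qed.

End Complete.

Section Degrees.
Variable G : sgraph.

Lemma min_deg_le (x : G) : (min_deg G <= deg x)%N.
Proof.
rewrite /min_deg; elim: index_enum (mem_index_enum x) => // y s IHs.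
rewrite inE big_cons => /predU1P[<-|/IHs]; first exact: geq_minl.
exact/leq_trans/geq_minr.
Qed.

Lemma deg_le_max (x : G) : (deg x <= max_deg G)%N.
Proof. exact: leq_bigmax. Qed.

Lemma min_deg_edge : (0 < #|G|)%N -> (0 < min_deg G)%N ->
  exists x y : G, adj x y.
Proof.
move=> /card_gt0P[x _] /leq_trans/(_ (min_deg_le x))/card_gt0P[y xy].
by exists x, y.
Qed.

End Degrees.

Theorem proposition3p9 (R : realType) :
  (forall G : sgraph, connected_graph G -> (2 <= min_deg G)%N ->
     ((min_deg G)%:R - 2%:R * Num.sqrt ((max_deg G)%:R - 1)
        <= magneto_spectral_height R G
        <= min_edge_deg G R - 1)
     /\
     (forall d : nat, regular_graph G d ->
        d%:R - 2%:R * Num.sqrt (d%:R - 1)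
          <= magneto_spectral_height R G
          <= d%:R - 1))
  /\
  (forall d : nat, (2 <= d)%N ->
     magneto_spectral_height R (complete_graph d.+1) = d%:R - 1).
Proof.
split=> [G [G0 _] m2|d d2].
  have [x [y xy]] := min_deg_edge G0 (ltnW m2).
  have lower m M : (2 <= M)%N -> (forall z : G, (m <= deg z <= M)%N) ->
      m%:R - 2%:R * Num.sqrt (M%:R - 1) <= magneto_spectral_height R G.
    case: M => // M M2 degb; rewrite -[M.+1%:R]natr1 addrK.
    exact: height_lower xy M2 degb.
  have upper := height_edge_le R xy.
  split=> [|d dreg]; apply/andP; split.
  - apply: lower => [|z]; last by rewrite min_deg_le deg_le_max.
    exact: leq_trans m2 (leq_trans (min_deg_le x) (deg_le_max x)).
  - rewrite lerBrDr /min_edge_deg; apply: le_bigmin => [|[u v] /= uv].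
      have := deg_le_max x; have := deg_le_max y; rewrite -!(ler_nat R).
      by move: upper; lra.
    by have := height_edge_le R uv; lra.
  - apply: lower => [|z]; last by rewrite dreg leqnn.
    by rewrite -(dreg x); apply: leq_trans m2 (min_deg_le x).
  - by move: upper; rewrite !dreg; lra.
apply/le_anti/andP; split; last by apply: height_complete_ge; apply: ltnW.
have xy : adj (ord0 : complete_graph d.+1) (ord_max : complete_graph d.+1).
  by rewrite /= -val_eqE /= neq_ltn (ltnW d2).
by have := height_edge_le R xy; rewrite !deg_complete; lra.
Qed.
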